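(* Let $\mathcal{H}$ be a hypergraph with rank $r$ and $m$ hyperedges. If $\mathcal{H}$ contains an $r$-uniform collar $\mathcal{C}$ as a sub-hypergraph, then $\lambda=-r$ is an eigenvalue of the adjacency matrix $\mathbf{A}_{\mathcal{L}}$ of the line multigraph $\mathcal{L}(\mathcal{H})$.
   Context: A hypergraph $\mathcal{H}=(V,E)$ consists of a finite set $V$ of vertices and a set $E$ of non-empty subsets of $V$, called hyperedges. The hypergraph $\mathcal{H}$ is assumed simple (no hyperedge has cardinality one and no hyperedge is contained in another) and connected (any two vertices are joined by a path, i.e. an alternating sequence of distinct vertices and hyperedges in which each hyperedge contains the vertices immediately before and after it). The rank of $\mathcal{H}$ is the largest cardinality of its hyperedges (so $E\neq\emptyset$ when the rank is mentioned). A hypergraph is $k$-uniform if all its hyperedges have cardinality $k$. The line multigraph $\mathcal{L}(\mathcal{H})$ is the multigraph with vertex set $E$ in which two distinct vertices $e,f\in E$ are joined by exactly $|e\cap f|$ edges (no loops). The adjacency matrix of a multigraph has zero diagonal, and for $u\neq v$ its $(u,v)$ entry is the number of edges joining $u$ and $v$. A sub-hypergraph $(V',E')$ of $\mathcal{H}$ satisfies $V'\subseteq V$, $E'\subseteq E$ and $e\subseteq V'$ for all $e\in E'$; sub-hypergraphs need not be connected. The degree of a vertex in a hypergraph is the number of its hyperedges containing it. A hypergraph $\mathcal{C}$ (with at least one hyperedge) is a collar if it is $2$-regular (every vertex has degree exactly $2$ in $\mathcal{C}$) and it admits an edge $2$-coloring, i.e. a map $f:E(\mathcal{C})\to\{1,2\}$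 with $f(e_i)\neq f(e_j)$ for every pair of adjacent hyperedges (distinct hyperedges sharing at least one vertex). *)

(* Defs.v *)
From HB Require Import structures.
From mathcomp Require Import all_boot all_order all_algebra.

Set Implicit Arguments.
Unset Strict Implicit.
Unset Printing Implicit Defensive.

Import GRing.Theory Num.Theory.

(* The vertex set is a subset of an ambient finite type [T], so that a
   hypergraph and its sub-hypergraphs are objects of the same type. *)
Record hypergraph (T : finType) := Hypergraph {
  vertices : {set T};
  hyperedges : {set {set T}};
  hyperedges_sub : forall e, e \in hyperedges -> e \subset vertices;
  hyperedges_neq0 : forall e, e \in hyperedges -> e != set0
}.

Definition hyperedge (T : finType) (H : hypergraph T) : finType :=
  {e : {set T} | e \in hyperedges H}.

Definition simple_hypergraph (T : finType) (H : hypergraph T) : Prop :=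
  (forall e, e \in hyperedges H -> #|e| != 1) /\
  (forall e f, e \in hyperedges H -> f \in hyperedges H ->
     e != f -> ~~ (e \subset f)).

(* An alternating sequence x, e1, x1, e2, x2, ... is encoded by its first
   vertex [x] and the list of pairs (e1, x1), (e2, x2), ... *)
Fixpoint alternating_walk (T : finType) (H : hypergraph T) (x : T)
    (p : seq ({set T} * T)) : bool :=
  if p is (e, y) :: p' then
    [&& e \in hyperedges H, x \in e, y \in e & alternating_walk H y p']
  else true.

Definition hyperpath (T : finType) (H : hypergraph T) (x y : T)
    (p : seq ({set T} * T)) : bool :=
  [&& alternating_walk H x p, last x (unzip2 p) == y,
      uniq (x :: unzip2 p) & uniq (unzip1 p)].

Definition connected_hypergraph (T : finType) (H : hypergraph T) : Prop :=
  forall x y, x \in vertices H -> y \in vertices H -> exists p, hyperpath H x y p.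

(* Equal to 0 when there is no hyperedge. *)
Definition rank (T : finType) (H : hypergraph T) : nat :=
  \max_(e in hyperedges H) #|e|.

Definition uniform (T : finType) (k : nat) (H : hypergraph T) : Prop :=
  forall e, e \in hyperedges H -> #|e| = k.

Definition sub_hypergraph (T : finType) (C H : hypergraph T) : Prop :=
  vertices C \subset vertices H /\ hyperedges C \subset hyperedges H.

Definition degree (T : finType) (H : hypergraph T) (v : T) : nat :=
  #|[set e in hyperedges H | v \in e]|.

Definition regular (T : finType) (k : nat) (H : hypergraph T) : Prop :=
  forall v, v \in vertices H -> degree H v = k.

Definition adjacent_hyperedges (T : finType) (H : hypergraph T)
    (e f : hyperedge H) : bool :=
  (e != f) && (val e :&: val f != set0).

Definition edge_coloring (T : finType) (k : nat) (H : hypergraph T)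
    (c : hyperedge H -> 'I_k) : Prop :=
  forall e f, adjacent_hyperedges e f -> c e != c f.

Definition collar (T : finType) (C : hypergraph T) : Prop :=
  [/\ hyperedges C != set0, regular 2 C &
      exists c : hyperedge C -> 'I_2, edge_coloring c].

(* Loopless multigraphs, given by edge multiplicities. *)
Record multigraph := Multigraph {
  mg_vertex : finType;
  mg_mult : mg_vertex -> mg_vertex -> nat;
  mg_mult_sym : forall u v, mg_mult u v = mg_mult v u;
  mg_mult_loopless : forall u, mg_mult u u = 0
}.

Definition line_mult (T : finType) (H : hypergraph T) (e f : hyperedge H) : nat :=
  if e == f then 0 else #|val e :&: val f|.

Lemma line_mult_sym (T : finType) (H : hypergraph T) (e f : hyperedge H) :
  line_mult e f = line_mult f e.
Proof. by rewrite /line_mult eq_sym setIC. Qed.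

Lemma line_mult_loopless (T : finType) (H : hypergraph T) (e : hyperedge H) :
  line_mult e e = 0.
Proof. by rewrite /line_mult eqxx. Qed.

Definition line_multigraph (T : finType) (H : hypergraph T) : multigraph :=
  Multigraph (@line_mult_sym T H) (@line_mult_loopless T H).

(* Rows and columns follow the canonical enumeration of the vertex type. *)
Definition adjacency_mx (R : pzSemiRingType) (G : multigraph) :
    'M[R]_#|mg_vertex G| :=
  \matrix_(i, j) ((mg_mult (enum_val i) (enum_val j))%:R)%R.

(* Main.v *)
Require Import Defs.
From HB Require Import structures.
From mathcomp Require Import all_boot all_order all_algebra.

Set Implicit Arguments.
Unset Strict Implicit.
Unset Printing Implicit Defensive.

Import GRing.Theory Num.Theory.

(** Give the two colour classes of the collar the weights 1 and -1, and every
    other hyperedge the weight 0.  At each vertex the weights of the incident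
    hyperedges cancel; summing over the vertices of f, the sum over all e
    (including e = f) of |e :&: f| times the weight of e vanishes.  Dropping
    the term e = f leaves -|f| times the weight of f, where |f| = r unless
    that weight is 0. *)

Lemma line_multigraph_eigenvalue (R : numFieldType) (T : finType)
    (H : hypergraph T) (k : nat) (w : {set T} -> R) (e0 : {set T}) :
  e0 \in hyperedges H -> w e0 != 0%R ->
  (forall v, \sum_(e in hyperedges H | v \in e) w e = 0)%R ->
  (forall e, e \in hyperedges H -> w e != 0%R -> #|e| = k) ->
  eigenvalue (adjacency_mx R (line_multigraph H)) (- k%:R)%R.
Proof.
move=> He0 we0 vsum0 wcard; apply/eigenvalueP.
exists (\row_i w (val (enum_val i : hyperedge H)))%R; last first.
  apply/eqP => /rowP /(_ (enum_rank (Sub e0 He0 : hyperedge H))).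
  by rewrite !mxE enum_rankK /= => /eqP; rewrite (negPf we0).
apply/rowP => j; rewrite !mxE.
set f : hyperedge H := enum_val j.
transitivity (\sum_(e : hyperedge H) w (val e) * (line_mult e f)%:R)%R.
  rewrite [RHS](reindex _ (onW_bij _ (@enum_val_bij (hyperedge H)))) /=.
  by apply: eq_bigr => i _; rewrite !mxE.
have all0 : (\sum_(e : hyperedge H) w (val e) * #|val e :&: val f|%:R = 0)%R.
  rewrite -(big_sub (mem (hyperedges H)) (fun e => w e * #|e :&: val f|%:R)%R) /=.
  (* Double counting: the size of [e :&: val f] is the number of vertices of [f] lying in [e], so
     exchanging the sums leaves only vertex sums, each zero by [vsum0]. *)
  transitivity (\sum_(v in val f) \sum_(e in hyperedges H | v \in e) w e)%R.
    rewrite (exchange_big_dep (mem (hyperedges H))) /=; last by move=> v e _ /andP[].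
    apply: eq_bigr => e He.
    rewrite mulr_natr -sumr_const; apply: eq_bigl => v.
    by rewrite inE He andbC.
  by rewrite big1.
move: all0; rewrite (bigD1 f) //= setIid => /eqP.
rewrite addr_eq0 => /eqP all0.
rewrite (bigD1 f) //= /line_mult eqxx mulr0 add0r.
under eq_bigr => e /negPf -> do [].
(* If the weight of [f] is 0, both sides vanish whatever the size of [f]; otherwise [wcard] gives
   that size as [k]. *)
have [wf0|wf0] := eqVneq (w (val f)) 0%R.
  by apply: oppr_inj; rewrite -all0 wf0 mul0r mulr0 oppr0.
by apply: oppr_inj; rewrite -all0 (wcard _ (valP f) wf0) mulNr opprK mulrC.
Qed.

Section CollarWeight.

Variables (R : numFieldType) (T : finType) (C : hypergraph T).
Variable c : hyperedge C -> 'I_2.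

(** Defined on all sets, with default 0 off [C], so that it can be summed over the hyperedges of a
    larger hypergraph; colours 0 and 1 become the signs 1 and -1. *)
Definition color_weight (e : {set T}) : R :=
  oapp (fun e' => (-1) ^+ c e')%R 0%R (insub e).

Lemma color_weight_neq0 (e : {set T}) :
  (color_weight e != 0%R) = (e \in hyperedges C).
Proof.
rewrite /color_weight; case: insubP => [e' -> _|/negPf ->] /=.
  by rewrite signr_eq0.
by rewrite eqxx.
Qed.

(** A vertex of [C] lies in exactly two hyperedges; sharing it, they are adjacent and so have
    opposite signs. For any other [v] the sum is empty. *)
Lemma color_weight_vertex_sum (v : T) :
  regular 2 C -> edge_coloring c ->
  (\sum_(e in hyperedges C | v \in e) color_weight e = 0)%R.
Proof.
move=> reg2 col; have [Cv|nCv] := boolP (v \in vertices C); last first.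
  rewrite big1 // => e /andP[He ve]; case/negP: nCv.
  exact: (subsetP (hyperedges_sub He)).
have /eqP/cards2P[e [f [nef defE]]] := reg2 v Cv.
have inE_ g : (g \in hyperedges C) && (v \in g) = (g \in [set e; f]).
  by rewrite -defE inE.
have /andP[He ve] : (e \in hyperedges C) && (v \in e) by rewrite inE_ set21.
have /andP[Hf vf] : (f \in hyperedges C) && (v \in f) by rewrite inE_ set22.
rewrite (eq_bigl _ _ inE_) big_setU1 ?inE //= big_set1 /color_weight.
rewrite (insubT (mem (hyperedges C)) He) (insubT (mem (hyperedges C)) Hf) /=.
have /col : adjacent_hyperedges (Sub e He : hyperedge C) (Sub f Hf).
  rewrite /adjacent_hyperedges -val_eqE /= nef /=.
  by apply/set0Pn; exists v; rewrite inE ve.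
case: (c _) => [[|[|//]] ?]; case: (c _) => [[|[|//]] ?] //= _.
  by rewrite expr0 expr1 subrr.
by rewrite expr0 expr1 addNr.
Qed.

End CollarWeight.

Theorem theorem4p10 (R : numFieldType) (T : finType) (H C : hypergraph T)
    (r m : nat)
    (simpleH : simple_hypergraph H)
    (connectedH : connected_hypergraph H)
    (nonemptyH : hyperedges H != set0)
    (rankH : rank H = r)
    (sizeH : #|hyperedges H| = m)
    (subC : sub_hypergraph C H)
    (uniformC : uniform r C)
    (collarC : collar C) :
  eigenvalue (adjacency_mx R (line_multigraph H)) (- r%:R)%R.
Proof.
case: collarC => /set0Pn[e0 Ce0] reg2 [c col].
have sCH := subsetP subC.2.
apply: (@line_multigraph_eigenvalue _ _ _ _ (color_weight R c) e0).
- exact: sCH.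
- by rewrite color_weight_neq0.
(* Hyperedges of [H] outside [C] have weight 0, so the vertex sums over [H] and over [C] agree. *)
- move=> v; rewrite -[RHS](color_weight_vertex_sum R v reg2 col).
  rewrite big_mkcond [RHS]big_mkcond; apply: eq_bigr => e _.
  have [Ce|nCe] := boolP (e \in hyperedges C); first by rewrite sCH.
  move: nCe; rewrite -(color_weight_neq0 R c) negbK => /eqP ->.
  by rewrite if_same.
- by move=> e _; rewrite color_weight_neq0 => /uniformC.
Qed.
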